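(* Let $M=\Gamma\backslash\mathbb{R}^4$ be the Kodaira-Thurston manifold, with global frame $\{E_1,E_2,E_3,E_4\}$ as in the context. Let $\lambda=\lambda(x_4)$, $\mu=\mu(x_4)$ be non-constant real-valued smooth $\mathbb{Z}$-periodic functions, and let $J=J_{\lambda,\mu}$ be the almost complex structure on $M$ defined by $$JE_1=e^{\lambda(x_4)}E_2,\quad JE_2=-e^{-\lambda(x_4)}E_1,\quad JE_3=e^{\mu(x_4)}E_4,\quad JE_4=-e^{-\mu(x_4)}E_3 .$$ Then $h^-_J(M)=2$.
   Context: Kodaira-Thurston manifold: on $\mathbb{R}^4$ with coordinates $(x_1,\dots,x_4)$ consider the group law $$x*y=(x_1+y_1,\;x_2+y_2,\;x_3+x_1y_2+y_3,\;x_4+y_4),$$ which makes $(\mathbb{R}^4,* )$ a nilpotent Lie group, and the uniform discrete subgroup $\Gamma=\mathbb{Z}^4\subset\mathbb{R}^4$. Then $M=\Gamma\backslash\mathbb{R}^4$ is a compact $4$-manifold. The $1$-forms $E^1=dx_1$, $E^2=dx_2$, $E^3=dx_3-x_1dx_2$, $E^4=dx_4$ are $\Gamma$-invariant and give a global coframe on $M$, with $dE^1=dE^2=dE^4=0$, $dE^3=-E^1\wedge E^2$; $\{E_1,\dots,E_4\}$ denotes the dual global frame, for which $[E_1,E_2]=E_3$ and the other brackets vanish. $\mathbb{Z}$-periodic functions of $x_4$ descend to functions on $M$. For an almost complex structure $J$ on $M$, a smooth real $2$-form $\alpha$ is $J$-anti-invariant if $\alpha(JX,JY)=-\alpha(X,Y)$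 for all vector fields $X,Y$; $h^-_J(M)$ denotes the dimension of the real vector space of closed $J$-anti-invariant $2$-forms on $M$. *)

(* Defs.v *)
From HB Require Import structures.
From mathcomp Require Import all_boot all_order all_algebra.
From mathcomp Require Import all_classical all_reals all_analysis.

Set Implicit Arguments.
Unset Strict Implicit.
Unset Printing Implicit Defensive.

Import Order.TTheory GRing.Theory Num.Theory.
Import numFieldNormedType.Exports.

Local Open Scope classical_set_scope.
Local Open Scope ring_scope.

Fixpoint Ck (R : realType) (V W : normedModType R) (k : nat) (f : V -> W) : Prop :=
  if k is k'.+1 then
    (forall x, differentiable f x) /\ (forall v : V, Ck k' ('D_v f))
  else continuous f.

Definition smooth (R : realType) (V W : normedModType R) (f : V -> W) : Prop :=
  forall k, Ck k f.

Definition has_dimension (R : fieldType) (V : lmodType R) (S : set V) (n : nat) : Prop :=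
  exists b : 'I_n -> V,
    (forall c : 'I_n -> R, \sum_(i < n) c i *: b i = 0 -> forall i, c i = 0) /\
    S = [set \sum_(i < n) c i *: b i | c in [set: 'I_n -> R]].

Section KodairaThurston.
Variable R : realType.

(* The coordinates x_1, x_2, x_3, x_4 of a point x are x 0 0, x 0 1, x 0 2,
   x 0 3; likewise E_1, ..., E_4 and E^1, ..., E^4 have indices 0, ..., 3
   below.  Every tangent space of R^4 is identified with R^4 itself. *)
Local Notation R4 := 'rV[R]_4.

Definition vec4 (a b c d : R) : R4 := \row_(i < 4) [:: a; b; c; d]`_i.

Definition kt_mul (x y : R4) : R4 :=
  vec4 (x 0 0 + y 0 0) (x 0 1 + y 0 1)
       (x 0 2 + x 0 0 * y 0 1 + y 0 2) (x 0 3 + y 0 3).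

Definition Gamma : set R4 := [set g | forall i, g 0 i \is a Num.int].

Definition coframe (i : 'I_4) (p v : R4) : R :=
  [:: v 0 0; v 0 1; v 0 2 - p 0 0 * v 0 1; v 0 3]`_i.

Definition frame (i : 'I_4) (p : R4) : R4 :=
  [:: vec4 1 0 0 0; vec4 0 1 (p 0 0) 0; vec4 0 0 1 0; vec4 0 0 0 1]`_i.

Lemma coframe_frame (i j : 'I_4) (p : R4) :
  coframe i p (frame j p) = (i == j)%:R.
Proof.
case: i => [[|[|[|[|//]]]] ?]; case: j => [[|[|[|[|//]]]] ?];
  rewrite /coframe /frame /vec4 /= !mxE //= ?mulr0 ?mulr1 ?subr0 ?subrr //.
Qed.

(* A smooth tensor field on the quotient of R^4 by Gamma is given by its
   pullback to R^4, i.e. by a smooth tensor field on R^4 that is invariant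
   under the left translations by elements of Gamma. *)
Definition vector_field_on_M (X : R4 -> R4) : Prop :=
  smooth X /\
  forall g p, Gamma g -> X (kt_mul g p) = 'd (kt_mul g) p (X p).

Definition almost_complex_on_M (J : R4 -> R4 -> R4) : Prop :=
  [/\ forall p, linear (J p),
      forall v, smooth (fun p => J p v),
      forall g p v, Gamma g ->
        J (kt_mul g p) ('d (kt_mul g) p v) = 'd (kt_mul g) p (J p v)
    & forall p v, J p (J p v) = - v].

(* The codomain R^o makes this function type an R-vector space. *)
Local Notation field2 := (R4 -> R4 -> R4 -> R^o).

Definition two_form_on_M (a : field2) : Prop :=
  [/\ forall p u, linear (a p u),
      forall p v, linear (fun u => a p u v),
      forall p v, a p v v = 0,
      forall u v, smooth (fun p => a p u v)
    & forall g p u v, Gamma g ->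
        a (kt_mul g p) ('d (kt_mul g) p u) ('d (kt_mul g) p v) = a p u v].

(* Exterior derivative, evaluated on constant vector fields of R^4: these
   commute, so the bracket terms of the invariant formula vanish. *)
Definition ext_d2 (a : field2) (p u v w : R4) : R :=
  'D_u (fun q => a q v w) p - 'D_v (fun q => a q u w) p
  + 'D_w (fun q => a q u v) p.

Definition closed2 (a : field2) : Prop := forall p u v w, ext_d2 a p u v w = 0.

Definition anti_invariant (J : R4 -> R4 -> R4) (a : field2) : Prop :=
  forall X Y, vector_field_on_M X -> vector_field_on_M Y ->
  forall p, a p (J p (X p)) (J p (Y p)) = - a p (X p) (Y p).

Definition closed_anti_invariant_forms (J : R4 -> R4 -> R4) : set field2 :=
  [set a | [/\ two_form_on_M a, anti_invariant J a & closed2 a]].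

Definition h_minus_is (J : R4 -> R4 -> R4) (n : nat) : Prop :=
  has_dimension (closed_anti_invariant_forms J) n.

End KodairaThurston.

(* Main.v *)
Require Import Defs.
From HB Require Import structures.
From mathcomp Require Import all_boot all_order all_algebra ring lra.
From mathcomp Require Import all_classical all_reals all_analysis.

(** A closed anti-invariant form is determined by two functions, and the claim
    is that both are constant.

    Write alpha_ij for the value of a form on the dual frame, and p4 for the
    last coordinate. Anti-invariance forces alpha_12 = alpha_34 = 0,
    alpha_24 = - exp(- lambda - mu) alpha_13 and
    alpha_14 = exp(lambda - mu) alpha_23 ([anti_invariant_components]), so that
    alpha is given by f = alpha_13 and g = alpha_23. These are also the values
    of alpha on pairs of constant coordinate vector fields, hence smooth, and
    invariance under Gamma makes them Gamma-invariant functions. The four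
    components of d alpha = 0 read
      E_4 f = exp(lambda - mu) E_3 g,    E_4 g = - exp(- lambda - mu) E_3 f,
      E_2 f = E_1 g,                     E_2 g = - exp(- 2 lambda) E_1 f.

    The first two equations live on the tori in the directions x3, x4, the
    last two on those in the directions x1, x2 once f and g no longer depend on
    x3. Each pair is a Beltrami-type system: the Jacobian of (f, g) in the two
    directions is a sum of squares of derivatives with positive weights.
    On the other hand the Jacobian of a map from a torus to the plane is a
    divergence and integrates to zero; being nonnegative it vanishes
    ([ge0_jacobian_eq0]), and so do all derivatives in the two directions
    ([periodic_beltrami_eq0]). Applying this twice shows that f and g are
    constant ([closed_anti_invariant_form_rigid]).

    Conversely, constants f = c and g = d do give a closed form: the forms
    E^13, E^24, E^14 and E^23 are closed, and so are the products of the middle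
    two with functions of x4. The space is thus parametrised linearly and
    injectively by (c, d). *)

Set Implicit Arguments.
Unset Strict Implicit.
Unset Printing Implicit Defensive.

Import Order.TTheory GRing.Theory Num.Theory.
Import numFieldNormedType.Exports.

Local Open Scope classical_set_scope.
Local Open Scope ring_scope.

(** * Directional derivatives of smooth functions *)

Section Calculus.
Variables (R : realType) (V : normedModType R).
Implicit Types (f g : V -> R^o) (p q u v w : V).

Lemma smooth_differentiable f p : smooth f -> differentiable f p.
Proof. by move=> /(_ 1%N) []. Qed.

Lemma smooth_derive f v : smooth f -> smooth ('D_v f).
Proof. by move=> fs k; have [_] := fs k.+1; exact. Qed.

Lemma smooth_continuous f : smooth f -> continuous f.
Proof. exact: (fun H => H 0%N). Qed.

Lemma is_derive_line f q v (t : R) :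
  derivable f (q + t *: v) v ->
  is_derive t 1 (fun x : R => f (q + x *: v) : R^o) ('D_v f (q + t *: v)).
Proof.
have E : (fun h : R => h^-1 *:
        (((fun x : R => f (q + x *: v) : R^o) \o shift t) (h *: (1 : R^o))
         - f (q + t *: v))) =
    (fun h : R => h^-1 *: ((f \o shift (q + t *: v)) (h *: v) - f (q + t *: v))).
  apply/funext => h /=; congr (_ *: (f _ - _)).
  by rewrite scalerDl addrCA [h%:A]mulr1.
by move=> df; apply: DeriveDef; rewrite /derivable /derive E.
Qed.

Lemma smooth_is_derive_line f q v (t : R) : smooth f ->
  is_derive t 1 (fun x : R => f (q + x *: v) : R^o) ('D_v f (q + t *: v)).
Proof.
by move=> /smooth_differentiable fs; exact/is_derive_line/diff_derivable/fs.
Qed.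

Lemma derive0_line f v : smooth f -> (forall p, 'D_v f p = 0) ->
  forall p (s : R), f (p + s *: v) = f p.
Proof.
move=> fs f0 p s.
have := @is_derive_0_is_cst R (fun x : R => f (p + x *: v)) s 0.
rewrite scale0r addr0; apply=> x.
by rewrite -(f0 (p + x *: v)); exact: smooth_is_derive_line.
Qed.

Lemma smooth_line_continuous f q v : smooth f ->
  continuous (fun x : R => f (q + x *: v) : R^o).
Proof.
move=> fs x; apply: differentiable_continuous; apply/derivable1_diffP.
by have [] := smooth_is_derive_line q v x fs.
Qed.

(** Two applications of the mean value theorem; exchanging u and v in the
    right-hand side only exchanges two of its terms, which is what makes mixed
    derivatives commute. *)
Lemma second_difference f p u v (e : R) : smooth f -> 0 < e ->
  exists s t : R, [/\ 0 < s < e, 0 < t < e &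
    'D_v ('D_u f) (p + s *: u + t *: v) =
    (f (p + e *: u + e *: v) - f (p + e *: u) - f (p + e *: v) + f p) / e ^+ 2].
Proof.
move=> fs e0.
pose g (x : R) := f (p + e *: v + x *: u) - f (p + x *: u).
have [s|s|s se] := @MVT R g
    (fun s => 'D_u f (p + e *: v + s *: u) - 'D_u f (p + s *: u)) 0 e e0.
- by move=> _; apply: is_deriveB; exact: smooth_is_derive_line.
- apply: continuous_subspaceT => x; apply: differentiable_continuous.
  apply/derivable1_diffP.
  by have [] : is_derive x 1 g ('D_u f (p + e *: v + x *: u) - 'D_u f (p + x *: u))
    by apply: is_deriveB; exact: smooth_is_derive_line.
rewrite subr0 => gE.
pose k (x : R) := 'D_u f (p + s *: u + x *: v).
have us : smooth ('D_u f) by exact: smooth_derive.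
have [t|t|t te] := @MVT R k (fun t => 'D_v ('D_u f) (p + s *: u + t *: v)) 0 e e0.
- by move=> _; exact: smooth_is_derive_line.
- apply: continuous_subspaceT => x.
  exact: (smooth_line_continuous us).
rewrite subr0 => kE.
exists s, t; split; [by rewrite in_itv in se|by rewrite in_itv in te|].
have e20 : e ^+ 2 != 0 by rewrite expf_neq0// gt_eqF.
apply: (canRL (mulfK e20)).
rewrite expr2 mulrA -kE /k scale0r addr0 (addrAC p (s *: u)) -gE /g scale0r !addr0.
by rewrite (addrAC p (e *: v)) opprB addrA (addrAC _ (f p)).
Qed.

Definition plane p u v (x : R * R) := p + x.1 *: u + x.2 *: v.

Lemma plane_continuous p u v : continuous (plane p u v).
Proof.
move=> x; apply: cvgD; first apply: cvgD.
- exact: cvg_cst.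
- by apply: cvgZr_tmp; exact: cvg_fst.
- by apply: cvgZr_tmp; exact: cvg_snd.
Qed.

Let dist_lt_half (a b c e : R) :
  `|b - c| < e / 2 -> `|a - c| < e / 2 -> `|a - b| <= e.
Proof.
by rewrite !ltr_norml ler_norml => /andP[? ?] /andP[? ?]; apply/andP; split; lra.
Qed.

Lemma derive_comm f u v p : smooth f -> 'D_v ('D_u f) p = 'D_u ('D_v f) p.
Proof.
move=> fs.
have planec g : smooth g -> g (plane p u v x) @[x --> (0, 0)] --> g p.
  move=> gs; have -> : g p = g (plane p u v (0, 0)).
    by rewrite /plane !scale0r !addr0.
  apply: (@continuous_comp _ _ _ (plane p u v) g).
    exact: plane_continuous.
  exact: smooth_continuous.
have /planec cvu : smooth ('D_v ('D_u f)) by do 2! apply: smooth_derive.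
have /planec cuv : smooth ('D_u ('D_v f)) by do 2! apply: smooth_derive.
apply/eqP; rewrite -subr_eq0 -normr_le0; apply/ler_addgt0Pl => e e0.
rewrite addr0.
have e20 : 0 < e / 2 by rewrite divr_gt0.
have /cvgrPdist_lt/(_ _ e20)/nbhs_ballP[r /= r0 vuP] := cvu.
have /cvgrPdist_lt/(_ _ e20)/nbhs_ballP[r' /= r'0 uvP] := cuv.
pose d := Num.min r r' / 2.
have m0 : 0 < Num.min r r' by rewrite lt_min r0.
have d0 : 0 < d by rewrite divr_gt0.
have dr : d < r /\ d < r'.
  by apply/andP; rewrite -lt_min ltr_pdivrMr// ltr_pMr// ltr1n.
have ball0 x y z : 0 < x < d -> 0 < y < d -> d < z -> ball (0 : R, 0 : R) z (x, y).
  move=> /andP[x0 xd] /andP[y0 yd] dz; split; rewrite /ball /= sub0r normrN gtr0_norm//.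
    exact: (lt_trans _ dz).
  exact: (lt_trans _ dz).
(* Both mixed derivatives take the value of the same difference quotient,
   at points of the plane within d of p. *)
have [s [t [sd td E1]]] := second_difference p u v fs d0.
have [t' [s' [t'd s'd E2]]] := second_difference p v u fs d0.
have {E1 E2} E : 'D_v ('D_u f) (p + s *: u + t *: v) =
                 'D_u ('D_v f) (p + s' *: u + t' *: v).
  rewrite E1 (addrAC p (s' *: u)) E2 (addrAC p (d *: v)); congr (_ / _).
  by congr (_ + _); exact: addrAC.
have := vuP _ (ball0 _ _ _ sd td dr.1).
have := uvP _ (ball0 _ _ _ s'd t'd dr.2).
rewrite -[plane p u v (s', t')]/(p + s' *: u + t' *: v) -E.
exact: dist_lt_half.
Qed.

Lemma derive_periodic f u v : (forall p, f (p + v) = f p) ->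
  forall p, 'D_u f (p + v) = 'D_u f p.
Proof.
move=> fv p; rewrite /derive; set F := (X in fmap X); set G := (X in _ = lim (fmap X _)).
have -> // : F = G.
by apply/funext => h; rewrite /F /G /= addrA !fv.
Qed.

End Calculus.

(** * A nonnegative divergence on a torus vanishes *)

Lemma Rintegral_eq0_continuous (R : realType) (w : R -> R) : continuous w ->
  (forall x, 0 <= w x) -> \int[lebesgue_measure]_(x in `[0, 1]) w x = 0 ->
  forall x, 0 < x < 1 -> w x = 0.
Proof.
move=> wc w0 intw x /andP[x0 x1]; apply/eqP; apply: contraT => wx0.
have wxgt0 : 0 < w x by rewrite lt_neqAle eq_sym wx0 w0.
have : \forall y \near x, w x / 2 < w y /\ 0 < y < 1.
  near=> y; split; last by apply/andP; split; near: y; [exact: lt_nbhsr|exact: lt_nbhsl].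
  near: y; apply: (cvgr_gt (w x)); first exact: wc.
  lra.
(* w exceeds w x / 2 on an interval of length r, where it contributes at least
   r * w x / 2 to the integral. *)
move=> /nbhs_ballP[r /= r0 rP].
have ab : x - r / 2 < x + r / 2 by lra.
have rP' y : y \in `[x - r / 2, x + r / 2] -> w x / 2 < w y /\ 0 < y < 1.
  rewrite in_itv/= => /andP[xy yx]; apply: rP.
  by rewrite /ball/= ltr_norml; apply/andP; split; lra.
have wi a b : lebesgue_measure.-integrable `[a, b] (EFin \o w).
  apply: continuous_compact_integrable; first exact: segment_compact.
  exact: continuous_subspaceT.
suff : (0 < \int[lebesgue_measure]_(x in `[0%R, 1%R]) (w x)%:E)%E.
  have /fineK <- : (\int[lebesgue_measure]_(x in `[0%R, 1%R]) (w x)%:E \is a fin_num)%E.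
    exact: (integrable_fin_num _ (wi 0 1)).
  by rewrite [fine _]intw ltxx.
apply: (@lt_le_trans _ _
  (\int[lebesgue_measure]_(x in `[(x - r / 2)%R, (x + r / 2)%R]) (w x)%:E)%E); last first.
  apply: ge0_subset_integral => //.
  - by have /integrableP[] := wi 0 1.
  - by move=> y _; rewrite lee_fin.
  - by move=> y /rP'[_ /andP[y0 y1]]; rewrite /= in_itv/= !ltW.
apply: (@lt_le_trans _ _
  (\int[lebesgue_measure]_(y in `[(x - r / 2)%R, (x + r / 2)%R]) (w x / 2)%:E)%E); last first.
  apply: ge0_le_integral => //.
  - by move=> y _; rewrite lee_fin divr_ge0.
  - by have /integrableP[] := wi (x - r / 2) (x + r / 2).
  - by move=> y /rP'[/ltW]; rewrite lee_fin.
rewrite integral_cst// (_ : _ `[_, _]%classic = (x + r / 2 - (x - r / 2))%:E).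
  by rewrite -EFinM lte_fin; apply: mulr_gt0; [lra|lra].
by apply: (etrans (lebesgue_measure_itv _)); rewrite /= lte_fin ab.
Unshelve. all: end_near. Qed.

Section PeriodicIntegrals.
Variables (R : realType) (V : normedModType R).
Implicit Types (f g : V -> R^o) (p q u v w : V).

Lemma smooth_parallel_line_continuous f p u v (t : R) : smooth f ->
  continuous (fun s : R => f (p + s *: u + t *: v) : R^o).
Proof.
move=> fs; have -> : (fun s : R => f (p + s *: u + t *: v) : R^o) =
    (fun s : R => f (p + t *: v + s *: u)).
  by apply/funext => s; rewrite addrAC.
exact: smooth_line_continuous.
Qed.

Lemma smooth_parallel_line_integrable f p u v (t : R) : smooth f ->
  lebesgue_measure.-integrable `[0%R, 1%R]
    (EFin \o fun s : R => f (p + s *: u + t *: v)).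
Proof.
move=> fs; apply: continuous_compact_integrable; first exact: segment_compact.
by apply: continuous_subspaceT; exact: (smooth_parallel_line_continuous fs).
Qed.

Lemma integral_derive_period f u p : smooth f -> (forall q, f (q + u) = f q) ->
  \int[lebesgue_measure]_(s in `[0, 1]) 'D_u f (p + s *: u) = 0.
Proof.
move=> fs fu.
rewrite /Rintegral (@continuous_FTC2 R _ (fun s : R => f (p + s *: u)) 0 1) //.
- by rewrite scale1r fu scale0r addr0 subee.
- by apply: continuous_subspaceT; exact: (smooth_line_continuous (smooth_derive u fs)).
- split.
  + by move=> x _; have [] := smooth_is_derive_line p u x fs.
  + by apply: cvg_at_right_filter; exact: (smooth_line_continuous fs).
  + by apply: cvg_at_left_filter; exact: (smooth_line_continuous fs).
- move=> x _; rewrite derive1E.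
  by have [_] := smooth_is_derive_line p u x fs.
Qed.

Lemma is_derive_integral_parallel_line f u v p (t : R) : smooth f ->
  is_derive t 1
    (fun t : R => \int[lebesgue_measure]_(s in `[0, 1]) f (p + s *: u + t *: v))
    (\int[lebesgue_measure]_(s in `[0, 1]) 'D_v f (p + s *: u + t *: v)).
Proof.
move=> fs.
have fc g : smooth g -> continuous (g \o plane p u v).
  move=> gs x; apply: continuous_comp; first exact: plane_continuous.
  exact: smooth_continuous.
have dfs := smooth_derive v fs.
have dline (y s : R) : is_derive y (1 : R) (fun x : R => f (p + s *: u + x *: v) : R^o)
    ('D_v f (p + s *: u + y *: v)) by exact: smooth_is_derive_line.
(* The derivative is bounded on a compact neighbourhood of [0, 1] x {t}, which
   gives the constant dominating function C. *)
pose K : set (R * R) := `[0, 1] `*` `[t - 1, t + 1].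
have [M [_ KM]] : bounded_set ((('D_v f) \o plane p u v) @` K).
  apply: compact_bounded; apply: continuous_compact.
    by apply: continuous_subspaceT; exact: fc dfs.
  by apply: compact_setX; exact: segment_compact.
pose C : R := `|M| + 1.
pose G (x s : R) : R := f (p + s *: u + x *: v).
have ub x s : x \in `]t - 1, t + 1[ -> s \in `[0, 1] ->
    `|partial1of2 G x s| <= C.
  move=> xt s01; rewrite partial1of2E (derive_val (is_derive := dline x s)).
  apply: (KM C); first by rewrite /C (le_lt_trans (ler_norm _))// ltrDl.
  exists (s, x) => //; split => //=.
  exact: subset_itv_oo_cc.
have tI : t \in `]t - 1, t + 1[ by rewrite in_itv/=; apply/andP; split; lra.
have C0 : 0 <= C by rewrite addr_ge0.
have Ci : lebesgue_measure.-integrable `[0%R, 1%R] (EFin \o fun _ : R => C).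
  apply: continuous_compact_integrable; first exact: segment_compact.
  by apply: continuous_subspaceT => x; exact: cvg_cst.
have Gi x : x \in `]t - 1, t + 1[ ->
    lebesgue_measure.-integrable `[0%R, 1%R] (EFin \o G x).
  by move=> _; exact: smooth_parallel_line_integrable.
have Gd x s : x \in `]t - 1, t + 1[ -> s \in `[0, 1] -> derivable (G ^~ s) x 1.
  by move=> _ _; have [] := dline x s.
apply: DeriveDef.
  exact: (@derivable_under_integral R _ _ lebesgue_measure G `[0, 1] _ t _ _ tI
    Gi Gd (fun=> C)).
rewrite -derive1E.
apply: etrans (_ : _ = \int[lebesgue_measure]_(s in `[0, 1]) partial1of2 G t s) _.
  exact: (differentiation_under_integral _ tI Gi Gd (fun=> C0) Ci ub).
apply: eq_Rintegral => s _; rewrite partial1of2E.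
by have [_] := dline t s.
Qed.

(** Integrating over one period in the direction u removes the term 'D_u g.
    What is left says that the mean A of f over that period has the integral of
    the divergence as derivative, so A is nondecreasing; being periodic, it is
    constant and the integral is zero. *)
Lemma ge0_divergence_eq0 f g u v : smooth f -> smooth g ->
  (forall p, f (p + v) = f p) -> (forall p, g (p + u) = g p) ->
  (forall p, 0 <= 'D_v f p + 'D_u g p) ->
  forall p, 'D_v f p + 'D_u g p = 0.
Proof.
move=> fs gs fv gu div0 p.
have half01 : 0 < (2^-1 : R) < 1 by apply/andP; split; lra.
(* The period starts half way before p, so that p lies in its interior. *)
pose q := p - 2^-1 *: u - 2^-1 *: v.
pose W (t s : R) : R :=
  'D_v f (q + s *: u + t *: v) + 'D_u g (q + s *: u + t *: v).
pose A (t : R) : R :=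
  \int[lebesgue_measure]_(s in `[0, 1]) f (q + s *: u + t *: v).
have dfs := smooth_derive v fs.
have dgs := smooth_derive u gs.
have dA (t : R) : is_derive t (1 : R) A (\int[lebesgue_measure]_(s in `[0, 1]) W t s).
  have fi := smooth_parallel_line_integrable q u v t dfs.
  have gi := smooth_parallel_line_integrable q u v t dgs.
  rewrite /W RintegralD//.
  have -> : \int[lebesgue_measure]_(s in `[0, 1]) 'D_u g (q + s *: u + t *: v) = 0.
    under eq_Rintegral => s _ do rewrite addrAC.
    exact: integral_derive_period.
  by rewrite addr0; exact: is_derive_integral_parallel_line.
have A10 : A 1 = A 0.
  by apply: eq_Rintegral => s _; rewrite scale1r fv scale0r addr0.
have Amono x y : 0 <= x -> x <= y -> y <= 1 -> A x <= A y.
  apply: ger0_derive1_ndecr.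
  - by move=> z _; have [] := dA z.
  - move=> z _; rewrite derive1E; have [_ ->] := dA z.
    by apply: Rintegral_ge0 => s _; exact: div0.
  - apply: continuous_subspaceT => z; apply: differentiable_continuous.
    by apply/derivable1_diffP; have [] := dA z.
have Acst x : 0 <= x <= 1 -> A x = A 0.
  move=> /andP[x0 x1]; apply/eqP; rewrite eq_le (Amono 0 x)// andbT -A10.
  exact: Amono.
have W0 : \int[lebesgue_measure]_(s in `[0, 1]) W 2^-1 s = 0.
  have [_ <-] := dA 2^-1.
  rewrite -(derive_cst (A 0) (2^-1 : R) (1 : R)); apply: near_eq_derive.
  near=> x; apply: Acst; apply/andP; split; apply: ltW; near: x.
    by apply: lt_nbhsr; case/andP: half01.
  by apply: lt_nbhsl; case/andP: half01.
have Wc : continuous (W 2^-1).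
  move=> s; apply: cvgD.
    exact: (smooth_parallel_line_continuous dfs).
  exact: (smooth_parallel_line_continuous dgs).
have := Rintegral_eq0_continuous Wc (fun s => div0 _) W0 half01.
rewrite /W; have -> // : q + 2^-1 *: u + 2^-1 *: v = p.
by rewrite /q (addrAC p) subrK subrK.
Unshelve. all: end_near. Qed.

End PeriodicIntegrals.

(** * Closure properties of smoothness *)

Section Smoothness.
Variables (R : realType) (V : normedModType R).
Implicit Types (f g : V -> R^o) (k : nat).

Lemma Ck_continuous (W : normedModType R) k (f : V -> W) : Ck k f -> continuous f.
Proof. by case: k => [//|k] [df _] x; exact: differentiable_continuous. Qed.

Lemma Ck_pred (W : normedModType R) k (f : V -> W) : Ck k.+1 f -> Ck k f.
Proof.
elim: k f => [|k IH] f; first exact: Ck_continuous.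
by move=> [df Df]; split=> // v; exact: IH.
Qed.

Lemma Ck_cst (W : normedModType R) k (c : W) : Ck k (fun _ : V => c).
Proof.
elim: k c => [|k IH] c; first by move=> x; exact: cvg_cst.
split=> [x|v]; first exact: differentiable_cst.
have -> : 'D_v (fun=> c) = (fun=> 0 : W).
  by apply/funext => x; exact: derive_cst.
exact: IH.
Qed.

Lemma CkD (W : normedModType R) k (f g : V -> W) : Ck k f -> Ck k g ->
  Ck k (fun x => f x + g x).
Proof.
elim: k f g => [|k IH] f g.
  by move=> fc gc x; apply: cvgD; [exact: fc|exact: gc].
move=> [df Df] [dg Dg]; split=> [x|v]; first exact: differentiableD.
have -> : 'D_v (fun x => f x + g x) = (fun x => 'D_v f x + 'D_v g x).
  by apply/funext => x; apply: deriveD; exact: diff_derivable.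
exact: (IH _ _ (Df v) (Dg v)).
Qed.

Lemma CkM k f g : Ck k f -> Ck k g -> Ck k (fun x => f x * g x).
Proof.
elim: k f g => [|k IH] f g.
  by move=> fc gc x; apply: cvgM; [exact: fc|exact: gc].
move=> fk gk; have [df Df] := fk; have [dg Dg] := gk.
split=> [x|v]; first exact: differentiableM.
have -> : 'D_v (fun x => f x * g x) = (fun x => f x * 'D_v g x + g x * 'D_v f x).
  by apply/funext => x; apply: deriveM; exact: diff_derivable.
apply: CkD; first exact: (IH _ _ (Ck_pred fk) (Dg v)).
exact: (IH _ _ (Ck_pred gk) (Df v)).
Qed.

Lemma CkZl (W : normedModType R) k f (w : W) : Ck k f -> Ck k (fun x => f x *: w).
Proof.
elim: k f => [|k IH] f; first by move=> fc x; apply: cvgZr_tmp; exact: fc.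
move=> [df Df]; split=> [x|v]; first exact: differentiableZl.
have -> : 'D_v (fun x => f x *: w) = (fun x => 'D_v f x *: w).
  apply/funext => x; rewrite !deriveE//; last exact: differentiableZl.
  by rewrite diffZl.
exact: (IH _ (Df v)).
Qed.

Lemma derive_expR_comp f v x : differentiable f x ->
  'D_v (fun x => expR (f x) : R^o) x = expR (f x) * 'D_v f x.
Proof.
move=> df.
have dexp : differentiable (expR : R^o -> R^o) (f x).
  by apply/derivable1_diffP; exact: derivable_expR.
rewrite !deriveE//; last exact: (differentiable_comp df).
rewrite (diff_comp df)// [LHS]/comp diff1E// derive1E.
have -> : 'D_1 (expR : R^o -> R^o) (f x) = expR (f x).
  exact: (congr1 (@^~ (f x)) (@derive_expR R)).
exact: mulrC.
Qed.

Lemma Ck_expR k f : Ck k f -> Ck k (fun x => expR (f x) : R^o).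
Proof.
elim: k f => [|k IH] f.
  by move=> fc x; apply: continuous_comp; [exact: fc|exact: continuous_expR].
move=> fk; have [df Df] := fk; split=> [x|v].
  apply: (differentiable_comp (df x)).
  by apply/derivable1_diffP; exact: derivable_expR.
have -> : 'D_v (fun x => expR (f x) : R^o) = (fun x => expR (f x) * 'D_v f x).
  by apply/funext => x; exact: derive_expR_comp.
exact: (CkM (IH _ (Ck_pred fk)) (Df v)).
Qed.

Lemma smooth_cst (W : normedModType R) (c : W) : smooth (fun _ : V => c).
Proof. by move=> k; exact: Ck_cst. Qed.

Lemma smoothD (W : normedModType R) (f g : V -> W) : smooth f -> smooth g ->
  smooth (fun x => f x + g x).
Proof. by move=> fs gs k; exact: CkD. Qed.

Lemma smoothM f g : smooth f -> smooth g -> smooth (fun x => f x * g x).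
Proof. by move=> fs gs k; exact: CkM. Qed.

Lemma smoothN f : smooth f -> smooth (fun x => - f x).
Proof.
move=> fs; have -> : (fun x => - f x) = (fun x => -1 * f x).
  by apply/funext => x; rewrite mulN1r.
exact: (smoothM (smooth_cst (-1 : R^o)) fs).
Qed.

Lemma smooth_expR f : smooth f -> smooth (fun x => expR (f x) : R^o).
Proof. by move=> fs k; exact: Ck_expR. Qed.

End Smoothness.

Section Coordinates.
Variables (R : realType) (n : nat).

Lemma derive_coord_comp (l : R^o -> R^o) (i : 'I_n) (v p : 'rV[R]_n) :
  'D_v (fun p : 'rV[R]_n => l (p 0 i)) p = 'D_(v 0 i) l (p 0 i).
Proof.
rewrite /derive; set F := (X in fmap X); set G := (X in _ = lim (fmap X _)).
have -> // : F = G.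
by apply/funext => h; rewrite /F /G /= !mxE.
Qed.

Lemma smooth_coord_comp (l : R^o -> R^o) (i : 'I_n) : smooth l ->
  smooth (fun p : 'rV[R]_n => l (p 0 i) : R^o).
Proof.
move=> ls k; elim: k l ls => [|k IH] l ls.
  move=> p; apply: (@continuous_comp _ _ _ (fun p : 'rV[R]_n => p 0 i) l).
    exact: coord_continuous.
  exact: smooth_continuous.
split=> [p|v].
  apply: (@differentiable_comp _ _ _ _ (fun p : 'rV[R]_n => p 0 i : R^o) l).
    exact: differentiable_coord.
  exact: smooth_differentiable.
have -> : 'D_v (fun p : 'rV[R]_n => l (p 0 i)) =
    (fun p : 'rV[R]_n => ('D_(v 0 i : R^o) l) (p 0 i)).
  by apply/funext => p; exact: derive_coord_comp.
exact: (IH _ (smooth_derive _ ls)).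
Qed.

Lemma smooth_coord (i : 'I_n) : smooth (fun p : 'rV[R]_n => p 0 i : R^o).
Proof.
apply: (@smooth_coord_comp id) => -[|k]; first by move=> x.
split=> [x|v]; first exact: ex_diff.
have -> : 'D_v (@id R^o) = (fun=> v) by apply/funext => x; exact: derive_id.
exact: Ck_cst.
Qed.

Lemma derive_coord (i : 'I_n) (v p : 'rV[R]_n) :
  'D_v (fun p : 'rV[R]_n => p 0 i : R^o) p = v 0 i.
Proof. by rewrite (derive_coord_comp id) derive_id. Qed.

End Coordinates.

(** * Beltrami systems on a torus *)

Lemma weighted_squares_eq0 (R : realDomainType) (a b x y : R) : 0 < a -> 0 < b ->
  a * x ^+ 2 + b * y ^+ 2 = 0 -> x = 0 /\ y = 0.
Proof.
move=> a0 b0 /eqP.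
have a1 := mulr_ge0 (ltW a0) (sqr_ge0 x); have b1 := mulr_ge0 (ltW b0) (sqr_ge0 y).
rewrite (paddr_eq0 a1 b1) !mulf_eq0 (gt_eqF a0) (gt_eqF b0)/= !orbb.
by move=> /andP[/eqP -> /eqP ->].
Qed.

Section Jacobian.
Variables (R : realType) (V : normedModType R).
Implicit Types (f g : V -> R^o) (p q u v w : V).

(** The Jacobian is the divergence, in the directions v and u, of the field with
    components f * 'D_u g and - f * 'D_v g: the second derivatives of g cancel
    because they commute. *)
Lemma ge0_jacobian_eq0 f g u v : smooth f -> smooth g ->
  (forall p, f (p + u) = f p) -> (forall p, f (p + v) = f p) ->
  (forall p, g (p + u) = g p) -> (forall p, g (p + v) = g p) ->
  (forall p, 0 <= 'D_v f p * 'D_u g p - 'D_u f p * 'D_v g p) ->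
  forall p, 'D_v f p * 'D_u g p - 'D_u f p * 'D_v g p = 0.
Proof.
move=> fs gs fu fv gu gv jac0.
have dus := smooth_derive u gs; have dvs := smooth_derive v gs.
have f1 p w : derivable f p w by exact/diff_derivable/smooth_differentiable.
have du1 p w : derivable ('D_u g) p w by exact/diff_derivable/smooth_differentiable.
have dv1 p w : derivable ('D_v g) p w by exact/diff_derivable/smooth_differentiable.
have jacE p : 'D_v f p * 'D_u g p - 'D_u f p * 'D_v g p =
    'D_v (fun p => f p * 'D_u g p) p + 'D_u (fun p => - (f p * 'D_v g p)) p.
  rewrite (deriveM (f1 p v) (du1 p v)) (deriveN (derivableM (f1 p u) (dv1 p u))).
  rewrite (deriveM (f1 p u) (dv1 p u)) (derive_comm u v p gs).
  rewrite /GRing.scale/=; ring.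
move=> p; rewrite jacE; apply: ge0_divergence_eq0.
- exact: smoothM.
- exact: (smoothN (smoothM fs dvs)).
- by move=> q; rewrite fv derive_periodic.
- by move=> q; rewrite fu derive_periodic.
- by move=> q; rewrite -jacE.
Qed.

(** For a = b = 1 these are the Cauchy-Riemann equations on a torus. The system
    makes the Jacobian a sum of squares of 'D_u f and 'D_u g with weights b and
    a, so that its vanishing kills both. *)
Lemma periodic_beltrami_eq0 f g u v (a b : V -> R) : smooth f -> smooth g ->
  (forall p, f (p + u) = f p) -> (forall p, f (p + v) = f p) ->
  (forall p, g (p + u) = g p) -> (forall p, g (p + v) = g p) ->
  (forall p, 0 < a p) -> (forall p, 0 < b p) ->
  (forall p, 'D_v f p = a p * 'D_u g p) ->
  (forall p, 'D_v g p = - (b p * 'D_u f p)) ->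
  forall p, [/\ 'D_u f p = 0, 'D_v f p = 0, 'D_u g p = 0 & 'D_v g p = 0].
Proof.
move=> fs gs fu fv gu gv a0 b0 Df Dg p.
have jacE q : 'D_v f q * 'D_u g q - 'D_u f q * 'D_v g q =
    a q * ('D_u g q) ^+ 2 + b q * ('D_u f q) ^+ 2.
  by rewrite Df Dg; ring.
have := ge0_jacobian_eq0 fs gs fu fv gu gv.
move=> /(_ _ p); rewrite jacE => jac0.
have /eqP : a p * ('D_u g p) ^+ 2 + b p * ('D_u f p) ^+ 2 = 0.
  apply: jac0 => q; rewrite jacE addr_ge0// mulr_ge0 ?sqr_ge0//; exact: ltW.
move=> /eqP/(weighted_squares_eq0 (a0 p) (b0 p))[g0 f0].
by rewrite Df Dg f0 g0 !mulr0 oppr0.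
Qed.

End Jacobian.

(** * The invariant frame and coframe *)

Section Frame.
Variable R : realType.
Local Notation R4 := 'rV[R]_4.
Local Notation e i := (delta_mx 0 i : R4).

Lemma big_ord4 (W : nmodType) (F : 'I_4 -> W) :
  \sum_(i < 4) F i = F 0 + F 1 + F 2 + F 3.
Proof.
rewrite !big_ord_recl big_ord0 addr0 !addrA.
by congr (F _ + F _ + F _ + F _); exact: val_inj.
Qed.

Lemma forall_ord4 (P : 'I_4 -> Prop) : P 0 -> P 1 -> P 2 -> P 3 -> forall i, P i.
Proof.
move=> P0 P1 P2 P3 i.
suff : [\/ i = 0, i = 1, i = 2 | i = 3] by case=> ->.
by case: i => [[|[|[|[|//]]]] ?];
  [apply: Or41|apply: Or42|apply: Or43|apply: Or44]; exact: val_inj.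
Qed.

Lemma frameE (p : R4) : [/\ frame 0 p = e 0, frame 1 p = e 1 + p 0 0 *: e 2,
  frame 2 p = e 2 & frame 3 p = e 3].
Proof.
split; apply/rowP; apply: forall_ord4; rewrite /frame/= !mxE/=; ring.
Qed.

Lemma kt_mulE (g p : R4) : kt_mul g p = g + p + p 0 1 *: (g 0 0 *: e 2).
Proof.
apply/rowP; apply: forall_ord4; rewrite /kt_mul !mxE/=; ring.
Qed.

Lemma diff_kt_mul (g p v : R4) : 'd (kt_mul g) p v = v + (v 0 1 * g 0 0) *: e 2.
Proof.
have coord1 : differentiable (fun q : R4 => q 0 1 : R^o) p by exact: differentiable_coord.
have -> : kt_mul g = (fun q => g + q + q 0 1 *: (g 0 0 *: e 2)).
  by apply/funext => q; exact: kt_mulE.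
have d1 : differentiable (fun q : R4 => g + q) p by exact: differentiableD.
have d2 : differentiable (fun q : R4 => q 0 1 *: (g 0 0 *: e 2)) p.
  exact: differentiableZl.
rewrite -(deriveE v (differentiableD d1 d2)).
(* The translation is affine, so its difference quotients are constant. *)
apply/lim_near_cst => //; near=> h.
have h0 : h != 0 by near: h; exact: nbhs_dnbhs_neq.
apply: (canLR (scalerK h0)).
apply/rowP => i; rewrite !mxE; ring.
Unshelve. all: end_near. Qed.

Lemma frame_decomposition (p v : R4) : v = \sum_(i < 4) coframe i p v *: frame i p.
Proof.
rewrite big_ord4; have [-> -> -> ->] := frameE p.
by apply/rowP; apply: forall_ord4; rewrite /coframe !mxE/=; ring.
Qed.

Lemma Gamma_delta (i : 'I_4) : Gamma (e i).
Proof. by move=> j; rewrite mxE; exact: natr_int. Qed.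

Lemma coframe_linear (i : 'I_4) (p : R4) : linear (coframe i p : R4 -> R^o).
Proof.
move: i; apply: forall_ord4 => k u v; rewrite /coframe/= !mxE /GRing.scale/=; ring.
Qed.

Lemma coframe_translate (i : 'I_4) (g p v : R4) :
  coframe i (kt_mul g p) ('d (kt_mul g) p v) = coframe i p v.
Proof.
rewrite diff_kt_mul kt_mulE.
by move: i; apply: forall_ord4; rewrite /coframe/= !mxE/=; ring.
Qed.

Lemma coframe_inj (p v w : R4) : (forall i, coframe i p v = coframe i p w) -> v = w.
Proof.
move=> vw; rewrite (frame_decomposition p v) (frame_decomposition p w).
by apply: eq_bigr => i _; rewrite vw.
Qed.

Lemma frame_vector_field (i : 'I_4) : vector_field_on_M (@frame R i).
Proof.
split; last first.
  move=> g p _; apply: (@coframe_inj (kt_mul g p)) => j.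
  by rewrite coframe_translate !coframe_frame.
move: i; apply: forall_ord4.
- have -> : @frame R 0 = (fun=> e 0) by apply/funext => p; have [] := frameE p.
  exact: smooth_cst.
- have -> : @frame R 1 = (fun p => e 1 + p 0 0 *: e 2).
    by apply/funext => p; have [] := frameE p.
  apply: smoothD; first exact: smooth_cst.
  by move=> k; apply: CkZl; exact: smooth_coord.
- have -> : @frame R 2 = (fun=> e 2) by apply/funext => p; have [] := frameE p.
  exact: smooth_cst.
- have -> : @frame R 3 = (fun=> e 3) by apply/funext => p; have [] := frameE p.
  exact: smooth_cst.
Qed.

Lemma linear_combination (W : lmodType R) (n : nat) (F : R4 -> W) (c : 'I_n -> R)
    (x : 'I_n -> R4) :
  linear F -> F (\sum_(i < n) c i *: x i) = \sum_(i < n) c i *: F (x i).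
Proof.
move=> lF; pose L : {linear R4 -> W} := HB.pack F (GRing.isLinear.Build _ _ _ _ _ lF).
by rewrite -[F]/(L : R4 -> W) linear_sum; apply: eq_bigr => i _; rewrite linearZ.
Qed.

Lemma constant_of_derive_eq0 (f : R4 -> R^o) : smooth f ->
  (forall i p, 'D_(e i) f p = 0) -> forall p, f p = f 0.
Proof.
move=> fs Df p.
have step i q (s : R) : f (q + s *: e i) = f q by exact: derive0_line.
have -> : p = 0 + p 0 0 *: e 0 + p 0 1 *: e 1 + p 0 2 *: e 2 + p 0 3 *: e 3.
  by rewrite add0r -(big_ord4 (fun i => p 0 i *: e i)) -row_sum_delta.
by rewrite !step.
Qed.

End Frame.

(** * A two-parameter family of closed forms *)

Section Solutions.
Variable R : realType.
Local Notation R4 := 'rV[R]_4.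

Definition wedge (i j : 'I_4) (p v w : R4) : R :=
  coframe i p v * coframe j p w - coframe j p v * coframe i p w.

(** With a = exp(- lambda - mu) and b = exp(lambda - mu), the coefficients of c
    and d are the real part and exp(lambda) times the imaginary part of the
    (2, 0)-form (E^1 + i exp(- lambda) E^2) /\ (E^3 + i exp(- mu) E^4). *)
Definition weighted_form (a b : R -> R) (c d : R) (p v w : R4) : R^o :=
  c * (wedge 0 2 p v w - a (p 0 3) * wedge 1 3 p v w) +
  d * (wedge 1 2 p v w + b (p 0 3) * wedge 0 3 p v w).

Variables a b : R -> R.
Hypothesis a_smooth : smooth (a : R^o -> R^o).
Hypothesis b_smooth : smooth (b : R^o -> R^o).
Hypothesis a_per : forall (t : R) (z : int), a (t + z%:~R) = a t.
Hypothesis b_per : forall (t : R) (z : int), b (t + z%:~R) = b t.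
Local Notation form := (weighted_form a b).

Lemma derive_function_of_x4 (psi : R^o -> R^o) (v p : R4) : smooth psi ->
  'D_v (fun p : R4 => psi (p 0 3) : R^o) p = v 0 3 * 'D_(1 : R^o) psi (p 0 3).
Proof.
move=> psis; have dpsi := smooth_differentiable (p 0 3) psis.
rewrite derive_coord_comp !deriveE// -[X in 'd _ _ X = _]mulr1.
by rewrite [LHS]linearZ.
Qed.

Lemma form_linear_r c d p u : linear (form c d p u).
Proof.
move=> k v w; rewrite /weighted_form /wedge !coframe_linear /GRing.scale/=; ring.
Qed.

Lemma form_linear_l c d p v : linear (fun u => form c d p u v).
Proof.
move=> k u w; rewrite /weighted_form /wedge !coframe_linear /GRing.scale/=; ring.
Qed.

Lemma form_alternating c d p v : form c d p v v = 0.
Proof. rewrite /weighted_form /wedge; ring. Qed.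

Lemma form_invariant c d g p u v : Gamma g ->
  form c d (kt_mul g p) ('d (kt_mul g) p u) ('d (kt_mul g) p v) = form c d p u v.
Proof.
move=> /(_ 3)/intrP[z gz].
have g3 : (kt_mul g p) 0 3 = p 0 3 + z%:~R by rewrite mxE/= addrC gz.
by rewrite /weighted_form g3 a_per b_per /wedge !coframe_translate.
Qed.

(** On constant vectors the form is affine in x1 and the two weights: x1 comes
    from E^3 and contributes to E^1 /\ E^3, but cancels in E^2 /\ E^3. *)
Lemma form_coordE c d v w : (fun p => form c d p v w) =
  (fun p => (c * (v 0 0 * w 0 2 - v 0 2 * w 0 0) +
             d * (v 0 1 * w 0 2 - v 0 2 * w 0 1) : R^o) +
   ((- c * (v 0 0 * w 0 1 - v 0 1 * w 0 0)) * p 0 0 +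
    ((- c * (v 0 1 * w 0 3 - v 0 3 * w 0 1)) * a (p 0 3) +
     (d * (v 0 0 * w 0 3 - v 0 3 * w 0 0)) * b (p 0 3)))).
Proof.
apply/funext => p; rewrite /weighted_form /wedge /coframe/=; ring.
Qed.

Let coord0_smooth : smooth (fun p : R4 => p 0 0 : R^o) := @smooth_coord R 4 0.
Let a4_smooth : smooth (fun p : R4 => a (p 0 3) : R^o) :=
  smooth_coord_comp (3 : 'I_4) a_smooth.
Let b4_smooth : smooth (fun p : R4 => b (p 0 3) : R^o) :=
  smooth_coord_comp (3 : 'I_4) b_smooth.

Lemma form_smooth c d v w : smooth (fun p => form c d p v w).
Proof.
have scaled (k : R) (f : R4 -> R^o) : smooth f -> smooth (fun p => k * f p : R^o).
  exact: (smoothM (smooth_cst _ (k : R^o))).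
rewrite form_coordE; apply: smoothD; first exact: smooth_cst.
apply: smoothD; first exact: (scaled _ _ coord0_smooth).
by apply: smoothD; [exact: (scaled _ _ a4_smooth)|exact: (scaled _ _ b4_smooth)].
Qed.

Lemma form_derive c d u v w p : 'D_u (fun p => form c d p v w) p =
   - c * (v 0 0 * w 0 1 - v 0 1 * w 0 0) * u 0 0 +
    (- c * (v 0 1 * w 0 3 - v 0 3 * w 0 1) *
       (u 0 3 * 'D_(1 : R^o) (a : R^o -> R^o) (p 0 3)) +
     d * (v 0 0 * w 0 3 - v 0 3 * w 0 0) *
       (u 0 3 * 'D_(1 : R^o) (b : R^o -> R^o) (p 0 3))).
Proof.
have drv (f : R4 -> R^o) : smooth f -> derivable f p u.
  by move=> fs; exact/diff_derivable/smooth_differentiable.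
have dZ (k : R) (f : R4 -> R^o) : smooth f ->
    is_derive p u (fun p => k * f p : R^o) (k * 'D_u f p).
  move=> fs; apply: DeriveDef.
    exact: drv (smoothM (smooth_cst _ (k : R^o)) fs).
  by apply: deriveMl; exact: drv.
rewrite form_coordE.
set k0 := c * _ + _; set k1 := - c * _; set k2 := - c * _; set k3 := d * _.
have [_ D] := is_deriveD (is_derive_cst (k0 : R^o) p u)
  (is_deriveD (dZ k1 _ coord0_smooth)
    (is_deriveD (dZ k2 _ a4_smooth) (dZ k3 _ b4_smooth))).
apply: (etrans D).
by rewrite add0r derive_coord !derive_function_of_x4.
Qed.

(** Each term of the cyclic sum is a multiple of a 3 x 3 determinant with a
    repeated row. *)
Lemma form_closed c d : closed2 (form c d).
Proof. move=> p u v w; rewrite /ext_d2 !form_derive; ring. Qed.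

Lemma form_two_form c d : two_form_on_M (form c d).
Proof.
split; [exact: form_linear_r|exact: form_linear_l|exact: form_alternating|
  exact: form_smooth|exact: form_invariant].
Qed.

End Solutions.

(** * Rigidity of closed anti-invariant forms *)

Section Rigidity.
Variables (R : realType) (lam mu : R -> R).
Local Notation R4 := 'rV[R]_4.
Local Notation e i := (delta_mx 0 i : R4).
Variable J : R4 -> R4 -> R4.
Hypothesis J_linear : forall p, linear (J p).
Hypothesis JE1 : forall p, J p (frame 0 p) = expR (lam (p 0 3)) *: frame 1 p.
Hypothesis JE2 : forall p, J p (frame 1 p) = - expR (- lam (p 0 3)) *: frame 0 p.
Hypothesis JE3 : forall p, J p (frame 2 p) = expR (mu (p 0 3)) *: frame 3 p.
Hypothesis JE4 : forall p, J p (frame 3 p) = - expR (- mu (p 0 3)) *: frame 2 p.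

(** The coefficients by which anti-invariance ties E^2 /\ E^4 to E^1 /\ E^3, and
    E^1 /\ E^4 to E^2 /\ E^3. *)
Definition weight24 (t : R) : R := expR (- lam t - mu t).
Definition weight14 (t : R) : R := expR (lam t - mu t).
Local Notation form := (weighted_form weight24 weight14).

Lemma coframe_J p v :
  [/\ coframe 0 p (J p v) = - expR (- lam (p 0 3)) * coframe 1 p v,
      coframe 1 p (J p v) = expR (lam (p 0 3)) * coframe 0 p v,
      coframe 2 p (J p v) = - expR (- mu (p 0 3)) * coframe 3 p v &
      coframe 3 p (J p v) = expR (mu (p 0 3)) * coframe 2 p v].
Proof.
have JE i : coframe i p (J p v) =
    coframe 0 p v * (expR (lam (p 0 3)) * (i == 1)%:R) +
    coframe 1 p v * (- expR (- lam (p 0 3)) * (i == 0)%:R) +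
    coframe 2 p v * (expR (mu (p 0 3)) * (i == 3)%:R) +
    coframe 3 p v * (- expR (- mu (p 0 3)) * (i == 2)%:R).
  have cZ (k : R) w : coframe i p (k *: w) = k * coframe i p w.
    by move: i; apply: forall_ord4; rewrite /coframe/= !mxE; ring.
  rewrite {1}(frame_decomposition p v) (linear_combination _ _ (J_linear p)).
  rewrite (linear_combination (W := R^o) _ _ (@coframe_linear R i p)) big_ord4.
  by rewrite JE1 JE2 JE3 JE4 !cZ !coframe_frame.
by split; rewrite JE/=; ring.
Qed.

Lemma form_anti_invariant c d : anti_invariant J (form c d).
Proof.
move=> X Y _ _ p; set v := X p; set w := Y p.
rewrite /weighted_form /wedge.
have [-> -> -> ->] := coframe_J p v; have [-> -> -> ->] := coframe_J p w.
rewrite /weight24 /weight14 !expRD !expRN.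
field.
by rewrite !gt_eqF ?expR_gt0.
Qed.

Variable alpha : R4 -> R4 -> R4 -> R^o.
Hypothesis alpha_form : two_form_on_M alpha.

Let alpha_linear_r p u : linear (alpha p u).
Proof. by case: alpha_form. Qed.
Let alpha_linear_l p v : linear (fun u => alpha p u v).
Proof. by case: alpha_form. Qed.
Let alpha_alt p v : alpha p v v = 0.
Proof. by case: alpha_form. Qed.
Let alpha_smooth u v : smooth (fun p => alpha p u v).
Proof. by case: alpha_form. Qed.

Let alphaDZr p u k v w : alpha p u (k *: v + w) = k * alpha p u v + alpha p u w.
Proof. exact: alpha_linear_r. Qed.
Let alphaDZl p u k v w : alpha p (k *: v + w) u = k * alpha p v u + alpha p w u.
Proof. exact: alpha_linear_l. Qed.
Let alpha0r p u : alpha p u 0 = 0.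
Proof.
by have := alphaDZr p u (-1) 0 0; rewrite scaler0 addr0 mulN1r addNr.
Qed.
Let alpha0l p u : alpha p 0 u = 0.
Proof.
by have := alphaDZl p u (-1) 0 0; rewrite scaler0 addr0 mulN1r addNr.
Qed.
Let alphaZr p u k v : alpha p u (k *: v) = k * alpha p u v.
Proof. by have := alphaDZr p u k v 0; rewrite !addr0 alpha0r addr0. Qed.
Let alphaZl p u k v : alpha p (k *: v) u = k * alpha p v u.
Proof. by have := alphaDZl p u k v 0; rewrite !addr0 alpha0l addr0. Qed.
Let alphaDl p u v w : alpha p (v + w) u = alpha p v u + alpha p w u.
Proof. by have := alphaDZl p u 1 v w; rewrite scale1r mul1r. Qed.
Let alphaDr p u v w : alpha p u (v + w) = alpha p u v + alpha p u w.
Proof. by have := alphaDZr p u 1 v w; rewrite scale1r mul1r. Qed.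
Let alpha_skew p u v : alpha p u v = - alpha p v u.
Proof.
by apply/eqP; rewrite -addr_eq0; apply/eqP; have := alpha_alt p (u + v);
  rewrite alphaDl !alphaDr !alpha_alt add0r addr0.
Qed.

Hypothesis alpha_anti : anti_invariant J alpha.

(** Anti-invariance evaluated on the pairs of frame fields (1, 2), (3, 4), (1, 3)
    and (1, 4). *)
Lemma anti_invariant_components p :
  [/\ alpha p (frame 0 p) (frame 1 p) = 0,
      alpha p (frame 2 p) (frame 3 p) = 0,
      alpha p (frame 1 p) (frame 3 p) =
        - (weight24 (p 0 3) * alpha p (frame 0 p) (frame 2 p)) &
      alpha p (frame 0 p) (frame 3 p) =
        weight14 (p 0 3) * alpha p (frame 1 p) (frame 2 p)].
Proof.
have anti i j := alpha_anti (@frame_vector_field R i) (@frame_vector_field R j) p.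
have x0 := expR_gt0 (lam (p 0 3)); have y0 := expR_gt0 (mu (p 0 3)).
have xN : expR (lam (p 0 3)) != 0 by rewrite gt_eqF.
have yN : expR (mu (p 0 3)) != 0 by rewrite gt_eqF.
rewrite /weight24 /weight14 !expRD !expRN; split.
- have := anti 0 1; rewrite JE1 JE2 alphaZl alphaZr expRN mulrA mulrN divff// mulN1r.
  by rewrite (alpha_skew _ (frame 1 p)) opprK; move=> ?; lra.
- have := anti 2 3; rewrite JE3 JE4 alphaZl alphaZr expRN mulrA mulrN divff// mulN1r.
  by rewrite (alpha_skew _ (frame 3 p)) opprK; move=> ?; lra.
- have := anti 0 2; rewrite JE1 JE3 alphaZl alphaZr => H.
  by rewrite -[alpha p (frame 0 p) _]opprK -H; field; rewrite xN yN.
- have := anti 0 3; rewrite JE1 JE4 alphaZl alphaZr expRN => H.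
  by rewrite -[alpha p (frame 0 p) _]opprK -H; field.
Qed.

Lemma form_of_frame_values c d :
  (forall p, alpha p (frame 0 p) (frame 2 p) = c) ->
  (forall p, alpha p (frame 1 p) (frame 2 p) = d) ->
  alpha = form c d.
Proof.
move=> fc hd; apply/funext => p; apply/funext => v; apply/funext => w.
have [a01 a23 a13 a03] := anti_invariant_components p.
rewrite {1}(frame_decomposition p v) {1}(frame_decomposition p w).
rewrite !big_ord4 !(alphaDl, alphaDr, alphaZl, alphaZr) !alpha_alt.
rewrite (alpha_skew _ (frame 1 p) (frame 0 p)) (alpha_skew _ (frame 2 p) (frame 0 p)).
rewrite (alpha_skew _ (frame 3 p) (frame 0 p)) (alpha_skew _ (frame 2 p) (frame 1 p)).
rewrite (alpha_skew _ (frame 3 p) (frame 1 p)) (alpha_skew _ (frame 3 p) (frame 2 p)).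
rewrite a01 a23 a13 a03 fc hd /weighted_form /wedge; ring.
Qed.

Hypothesis lam_smooth : smooth (lam : R^o -> R^o).
Hypothesis mu_smooth : smooth (mu : R^o -> R^o).

Lemma smooth_weight24 : smooth (weight24 : R^o -> R^o).
Proof. exact: (smooth_expR (smoothD (smoothN lam_smooth) (smoothN mu_smooth))). Qed.

Lemma smooth_weight14 : smooth (weight14 : R^o -> R^o).
Proof. exact: (smooth_expR (smoothD lam_smooth (smoothN mu_smooth))). Qed.

Hypothesis alpha_closed : closed2 alpha.

(* Since e_2 and E_2 differ by a multiple of e_3, these are also the components
   of alpha on (E_1, E_3) and (E_2, E_3). *)
Let f (p : R4) : R^o := alpha p (e 0) (e 2).
Let g (p : R4) : R^o := alpha p (e 1) (e 2).

Let f_smooth : smooth f. Proof. exact: alpha_smooth. Qed.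
Let g_smooth : smooth g. Proof. exact: alpha_smooth. Qed.

(** The components on the coordinate vectors, for which closedness takes its
    simplest form; they differ from the frame components because
    E_2 = e_2 + x1 e_3. *)
Lemma coordinate_components p :
  [/\ alpha p (e 0) (e 1) = - (p 0 0 * f p), alpha p (e 2) (e 3) = 0,
      alpha p (e 1) (e 3) = - (weight24 (p 0 3) * f p) &
      alpha p (e 0) (e 3) = weight14 (p 0 3) * g p].
Proof.
have [F0 F1 F2 F3] := frameE p.
have := anti_invariant_components p; rewrite F0 F1 F2 F3.
rewrite !alphaDl !alphaDr !alphaZl !alphaZr alpha_alt mulr0 addr0 -/(f p) -/(g p).
move=> [a01 a23 a13 a03]; split=> //; first by apply/eqP; rewrite -addr_eq0 a01.
by rewrite -a13 a23 mulr0 addr0.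
Qed.

Lemma derive_weighted (psi k : R4 -> R^o) u p : smooth psi -> smooth k ->
  'D_u psi p = 0 -> 'D_u (fun q => psi q * k q : R^o) p = psi p * 'D_u k p.
Proof.
move=> psis ks psi0.
have drv (q : R4 -> R^o) : smooth q -> derivable q p u.
  by move=> qs; exact/diff_derivable/smooth_differentiable.
apply: (etrans (deriveM (drv _ psis) (drv _ ks))).
by rewrite psi0 scaler0 addr0.
Qed.

(** Left translation by k adds to e_2 a multiple of e_3, which g does not see
    because alpha is alternating. *)
Lemma translation_invariance k p : Gamma k ->
  f (k + p + p 0 1 *: (k 0 0 *: e 2)) = f p /\
  g (k + p + p 0 1 *: (k 0 0 *: e 2)) = g p.
Proof.
case: alpha_form => _ _ _ _ inv Gk; rewrite -kt_mulE.
have := inv k p (e 0) (e 2) Gk; have := inv k p (e 1) (e 2) Gk.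
rewrite !diff_kt_mul !mxE/= !mul0r !scale0r !addr0 mul1r => gI fI.
split; first exact: fI.
by rewrite -[RHS]gI alphaDl alphaZl alpha_alt mulr0 addr0.
Qed.

Lemma periodic_direction i p : i != 0 -> f (p + e i) = f p /\ g (p + e i) = g p.
Proof.
move=> i0; have := translation_invariance p (@Gamma_delta R i).
by rewrite mxE (eq_sym 0 i) (negbTE i0) andbF scale0r scaler0 addr0 (addrC (e i)).
Qed.

Let weight_pos (t : R) : 0 < weight24 t /\ 0 < weight14 t.
Proof. by split; exact: expR_gt0. Qed.

Let W24 (p : R4) : R^o := weight24 (p 0 3).
Let W14 (p : R4) : R^o := weight14 (p 0 3).
Let W24s : smooth W24 := smooth_coord_comp (3 : 'I_4) smooth_weight24.
Let W14s : smooth W14 := smooth_coord_comp (3 : 'I_4) smooth_weight14.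

Let derive_W i p : i != 3 -> 'D_(e i) W24 p = 0 /\ 'D_(e i) W14 p = 0.
Proof.
move=> i3; rewrite (derive_function_of_x4 _ _ smooth_weight24).
rewrite (derive_function_of_x4 _ _ smooth_weight14).
by rewrite mxE (eq_sym 3 i) (negbTE i3) !mul0r.
Qed.

Let alpha12 : (fun p => alpha p (e 1) (e 2)) = g. Proof. by []. Qed.
Let alpha02 : (fun p => alpha p (e 0) (e 2)) = f. Proof. by []. Qed.
Let alpha23 : (fun p => alpha p (e 2) (e 3)) = (fun=> 0).
Proof. by apply/funext => p; have [] := coordinate_components p. Qed.
Let alpha01 : (fun p => alpha p (e 0) (e 1)) = (fun p => - (p 0 0 * f p)).
Proof. by apply/funext => p; have [] := coordinate_components p. Qed.
Let alpha13 : (fun p => alpha p (e 1) (e 3)) = (fun p => - (W24 p * f p)).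
Proof. by apply/funext => p; have [] := coordinate_components p. Qed.
Let alpha03 : (fun p => alpha p (e 0) (e 3)) = (fun p => W14 p * g p).
Proof. by apply/funext => p; have [] := coordinate_components p. Qed.

Let derive_opp (q : R4 -> R^o) u p : smooth q ->
  'D_u (fun p => - q p : R^o) p = - 'D_u q p.
Proof. by move=> qs; exact/deriveN/diff_derivable/smooth_differentiable. Qed.

Let derive_a13 i p : i != 3 ->
  'D_(e i) (fun p => alpha p (e 1) (e 3)) p = - (W24 p * 'D_(e i) f p).
Proof.
move=> i3; rewrite alpha13 derive_opp; last exact: smoothM.
by rewrite derive_weighted//; have [] := derive_W p i3.
Qed.

Let derive_a03 i p : i != 3 ->
  'D_(e i) (fun p => alpha p (e 0) (e 3)) p = W14 p * 'D_(e i) g p.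
Proof.
by move=> i3; rewrite alpha03 derive_weighted//; have [] := derive_W p i3.
Qed.

Let derive_a01 i p : i != 0 ->
  'D_(e i) (fun p => alpha p (e 0) (e 1)) p = - (p 0 0 * 'D_(e i) f p).
Proof.
move=> i0; rewrite alpha01 derive_opp; last exact: (smoothM (@smooth_coord R 4 0)).
rewrite derive_weighted//; first exact: smooth_coord.
by rewrite derive_coord mxE (eq_sym 0 i) (negbTE i0) andbF.
Qed.

Let derive_a23 u p : 'D_u (fun p => alpha p (e 2) (e 3)) p = 0.
Proof. by rewrite alpha23 derive_cst. Qed.

(** The components of d alpha on (e_1, e_3, e_4) and (e_2, e_3, e_4) are a
    Beltrami system in the directions x3 and x4. *)
Lemma components_constant_along_x3_x4 p :
  [/\ 'D_(e 2) f p = 0, 'D_(e 3) f p = 0, 'D_(e 2) g p = 0 & 'D_(e 3) g p = 0].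
Proof.
apply: (@periodic_beltrami_eq0 _ _ f g (e 2) (e 3) W14 W24) => //.
- by move=> q; have [] := @periodic_direction 2 q.
- by move=> q; have [] := @periodic_direction 3 q.
- by move=> q; have [] := @periodic_direction 2 q.
- by move=> q; have [] := @periodic_direction 3 q.
- by move=> q; have [] := weight_pos (q 0 3).
- by move=> q; have [] := weight_pos (q 0 3).
- move=> q; have := alpha_closed q (e 0) (e 2) (e 3).
  rewrite /ext_d2 derive_a23 derive_a03// alpha02 => H; lra.
- move=> q; have := alpha_closed q (e 1) (e 2) (e 3).
  rewrite /ext_d2 derive_a23 derive_a13// alpha12 => H; lra.
Qed.

(** The components of d alpha on (e_1, e_2, e_3) and (e_1, e_2, e_4) involve x1
    explicitly, but only multiplied by derivatives along x3 and x4, which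
    vanish. Likewise translation by e_1 shears x3, which f and g no longer see,
    so that they are periodic in x1. *)
Lemma components_constant_along_x1_x2 p :
  [/\ 'D_(e 0) f p = 0, 'D_(e 1) f p = 0, 'D_(e 0) g p = 0 & 'D_(e 1) g p = 0].
Proof.
have f2 q (s : R) : f (q + s *: e 2) = f q.
  by apply: derive0_line => // r; have [] := components_constant_along_x3_x4 r.
have g2 q (s : R) : g (q + s *: e 2) = g q.
  by apply: derive0_line => // r; have [] := components_constant_along_x3_x4 r.
have per0 q : f (q + e 0) = f q /\ g (q + e 0) = g q.
  have := translation_invariance q (@Gamma_delta R 0).
  by rewrite scalerA f2 g2 (addrC (e 0)).
apply: (@periodic_beltrami_eq0 _ _ f g (e 0) (e 1)
  (fun=> 1) (fun p => W24 p / W14 p)) => //.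
- by move=> q; have [] := per0 q.
- by move=> q; have [] := @periodic_direction 1 q.
- by move=> q; have [] := per0 q.
- by move=> q; have [] := @periodic_direction 1 q.
- by move=> q; have [? ?] := weight_pos (q 0 3); exact: divr_gt0.
- move=> q; have := alpha_closed q (e 0) (e 1) (e 2).
  rewrite /ext_d2 derive_a01// alpha12 alpha02.
  by have [-> _ _ _] := components_constant_along_x3_x4 q; rewrite mulr0 oppr0 => H; lra.
- move=> q; have := alpha_closed q (e 0) (e 1) (e 3).
  rewrite /ext_d2 derive_a01// derive_a13// derive_a03//.
  have [_ -> _ _] := components_constant_along_x3_x4 q; rewrite mulr0 oppr0 addr0.
  have W0 : W14 q != 0 by have [_ /gt_eqF ->] := weight_pos (q 0 3).
  move=> /eqP; rewrite subr_eq0 => /eqP H.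
  by apply: (mulfI W0); rewrite -H; field.
Qed.

Lemma closed_anti_invariant_form_rigid : alpha = form (f 0) (g 0).
Proof.
have fc : forall p, f p = f 0.
  apply: constant_of_derive_eq0 => //; apply: forall_ord4 => p; by
    [have [] := components_constant_along_x1_x2 p
    |have [] := components_constant_along_x3_x4 p].
have gc : forall p, g p = g 0.
  apply: constant_of_derive_eq0 => //; apply: forall_ord4 => p; by
    [have [] := components_constant_along_x1_x2 p
    |have [] := components_constant_along_x3_x4 p].
apply: form_of_frame_values => p; have [F0 F1 F2 _] := frameE p.
  by rewrite F0 F2; exact: fc.
by rewrite F1 F2 alphaDl alphaZl alpha_alt mulr0 addr0; exact: gc.
Qed.

End Rigidity.

Theorem proposition4p2 (R : realType) (lam mu : R -> R)
    (lam_smooth : smooth (lam : R^o -> R^o)) (mu_smooth : smooth (mu : R^o -> R^o))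
    (lam_per : forall (t : R) (z : int), lam (t + z%:~R) = lam t)
    (mu_per : forall (t : R) (z : int), mu (t + z%:~R) = mu t)
    (lam_nonconst : ~ exists c : R, forall t, lam t = c)
    (mu_nonconst : ~ exists c : R, forall t, mu t = c)
    (J : 'rV[R]_4 -> 'rV[R]_4 -> 'rV[R]_4)
    (J_ac : almost_complex_on_M J)
    (JE1 : forall p, J p (frame 0 p) = expR (lam (p 0 3)) *: frame 1 p)
    (JE2 : forall p, J p (frame 1 p) = - expR (- lam (p 0 3)) *: frame 0 p)
    (JE3 : forall p, J p (frame 2 p) = expR (mu (p 0 3)) *: frame 3 p)
    (JE4 : forall p, J p (frame 3 p) = - expR (- mu (p 0 3)) *: frame 2 p) :
  h_minus_is J 2.
Proof.
have J_linear : forall p, linear (J p) by case: J_ac.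
pose b (i : 'I_2) := weighted_form (weight24 lam mu) (weight14 lam mu)
  (i == 0)%:R (i == 1)%:R.
have bE (c : 'I_2 -> R) : \sum_(i < 2) c i *: b i =
    weighted_form (weight24 lam mu) (weight14 lam mu) (c 0) (c 1).
  rewrite !big_ord_recl big_ord0 addr0.
  apply/funext => p; apply/funext => v; apply/funext => w.
  have -> : lift ord0 ord0 = 1 :> 'I_2 by exact: val_inj.
  rewrite /b /weighted_form !fctE /GRing.scale/=; ring.
exists b; split.
  move=> c; rewrite bE => form0.
  (* The values on (E_1, E_3) and (E_2, E_3) at the origin are c 0 and c 1. *)
  have value v : weighted_form (weight24 lam mu) (weight14 lam mu) (c 0) (c 1)
      0 (@frame R v 0) (@frame R 2 0) = 0 by rewrite form0.
  have := value 0; have := value 1.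
  rewrite /weighted_form /wedge !coframe_frame/=.
  rewrite !(mulr0, mul0r, mulr1, subr0, oppr0, addr0, add0r).
  move=> c1 c0 i.
  have : i = 0 \/ i = 1 by case: i => [[|[|//]] ?]; [left|right]; exact: val_inj.
  by case=> ->.
apply/seteqP; split=> [alpha [alpha_form alpha_anti alpha_closed]|alpha [c _ <-]].
  exists (fun i => if i == 0 then alpha 0 (delta_mx 0 0) (delta_mx 0 2)
                   else alpha 0 (delta_mx 0 1) (delta_mx 0 2)) => //.
  rewrite bE/=; apply/esym.
  exact: (closed_anti_invariant_form_rigid JE1 JE2 JE3 JE4 alpha_form alpha_anti
    lam_smooth mu_smooth alpha_closed).
rewrite bE; split.
- apply: form_two_form.
  + exact: smooth_weight24.
  + exact: smooth_weight14.
  + by move=> t z; rewrite /weight24 lam_per mu_per.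
  + by move=> t z; rewrite /weight14 lam_per mu_per.
- exact: form_anti_invariant.
- apply: form_closed; [exact: smooth_weight24|exact: smooth_weight14].
Qed.
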